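(* There exists a universal constant $L>0$ such that the following holds. Let $\Psi$ denote the correlation matrix of the covariates $(X_i)_{1\le i\le p}$. Let $k$ be a positive integer smaller than $p/2$ and let $\delta>0$. Assume that $$(1-\delta)^2\|\theta\|^2\le\theta^*\Psi\theta\le(1+\delta)^2\|\theta\|^2$$ for all $\theta\in\mathbb{R}^p$ with at most $2k$ non-zero components. Then, for any $r>0$, the minimax rate of estimation over $\Theta[k,p](r)$ is lower bounded as follows: $$\inf_{\widehat\theta}\ \sup_{\theta\in\Theta[k,p](r)}\mathbb{E}_\theta\big[l(\widehat\theta,\theta)\big]\ \ge\ L(1-\delta)^2k\Big[r^2\wedge\sigma^2\frac{1+\log\left(\frac pk\right)}{(1+\delta)^2n}\Big],$$ where the infimum is over all estimators $\widehat\theta$ of $\theta$ based on the $n$ observations.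
   Context: Model: $Y=X\theta+\epsilon$, where $\theta\in\mathbb{R}^p$ is unknown, the row vector $X=(X_i)_{1\le i\le p}$ is a zero mean Gaussian vector with nonsingular covariance matrix $\Sigma$, and $\epsilon$ is a zero mean Gaussian variable with variance $\sigma^2$, independent of $X$. The correlation matrix $\Psi$ has entries $\Psi_{ij}=\Sigma_{ij}/\sqrt{\Sigma_{ii}\Sigma_{jj}}$. One observes $n$ i.i.d. replications of $(Y,X)$; $\mathbb{E}_\theta$ is the corresponding expectation. The loss is $l(\theta_1,\theta_2):=\mathbb{E}[(X\theta_1-X\theta_2)^2]$. $\|\cdot\|$ is the Euclidean norm on $\mathbb{R}^p$ and $\theta^*$ the transpose of $\theta$. $\Theta[k,p]$ is the set of vectors of $\mathbb{R}^p$ with at most $k$ non-zero coordinates, and, for $r>0$, $\Theta[k,p](r)$ is the subset of those with $|\theta_i|\le r$ for all $i$. $\wedge$ denotes the minimum.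
   Formalization: The formal theorem additionally assumes that every covariate has variance at least 1 (as for standardized covariates); without a normalization the bound is false, e.g. for Σ = cI with c → 0. *)

(* Defs.v *)
From HB Require Import structures.
From mathcomp Require Import all_boot all_order all_algebra.
From mathcomp Require Import all_classical all_reals all_analysis.

Set Implicit Arguments.
Unset Strict Implicit.
Unset Printing Implicit Defensive.

Import Order.TTheory GRing.Theory Num.Theory.
Import numFieldNormedType.Exports.

Local Open Scope classical_set_scope.
Local Open Scope ring_scope.

Section vectors.
Context {R : realType} {p : nat}.

(* The default norm of the library on matrices is the sup norm. *)
Definition enorm (theta : 'cV[R]_p) : R := Num.sqrt (\sum_i theta i 0 ^+ 2).

Definition sparse (k : nat) : set 'cV[R]_p :=
  [set theta | (#|[pred i | theta i ord0 != 0%R]| <= k)%N].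

Definition sparse_box (k : nat) (r : R) : set 'cV[R]_p :=
  [set theta | sparse k theta /\ forall i, `|theta i 0| <= r].

Definition correlation_mx (Sigma : 'M[R]_p) : 'M[R]_p :=
  \matrix_(i, j) (Sigma i j / Num.sqrt (Sigma i i * Sigma j j)).

(* The scalar [x theta], where the row vector [x] is a tuple: tuples, unlike
   matrices, carry the product sigma-algebra in the library. *)
Definition dotr (x : p.-tuple R) (theta : 'cV[R]_p) : R :=
  ((\row_i tnth x i) *m theta) 0 0.

End vectors.

Section independence.
Context {R : realType} {d : measure_display} {T : measurableType d}.
Variable P : probability T R.

Definition independent2 d1 d2 (U1 : measurableType d1) (U2 : measurableType d2)
    (Z1 : T -> U1) (Z2 : T -> U2) : Prop :=
  forall B1 B2, measurable B1 -> measurable B2 ->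
    (P (Z1 @^-1` B1 `&` Z2 @^-1` B2) = P (Z1 @^-1` B1) * P (Z2 @^-1` B2))%E.

Definition mutually_independent (I : finType) d' (U : measurableType d')
    (Z : I -> T -> U) : Prop :=
  forall (J : {set I}) (B : I -> set U), (forall i, measurable (B i)) ->
    (P (\bigcap_(i in [set` J]) (Z i @^-1` B i)) =
     \prod_(i in J) P (Z i @^-1` B i))%E.

End independence.

Section gaussian.
Context {R : realType} {d : measure_display} {T : measurableType d}.
Variable P : probability T R.

(* [Z] has the law N(m, s^2).  The case [s = 0] is separated because
   [normal_prob m 0] is not a Dirac mass in the library. *)
Definition normal_law (Z : T -> R) (m s : R) : Prop :=
  forall B : set R, measurable B ->
    P (Z @^-1` B) = if s == 0 then \d_m B else normal_prob m s B.

Definition gaussian_vector p (X : T -> p.-tuple R) : Prop :=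
  forall u : 'cV[R]_p,
    exists m s : R, 0 <= s /\ normal_law (fun w => dotr (X w) u) m s.

Record gaussian_design p (Sigma : 'M[R]_p) (sigma : R)
    (X : {RV P >-> p.-tuple R}) (eps : {RV P >-> R}) : Prop := {
  design_gaussian : gaussian_vector X ;
  design_mean : forall i, 'E_P[fun w => tnth (X w) i]%E = 0%E ;
  design_cov : forall i j,
    covariance P (fun w => tnth (X w) i) (fun w => tnth (X w) j) =
    (Sigma i j)%:E ;
  design_nonsingular : Sigma \in unitmx ;
  noise_normal : normal_law eps 0 sigma ;
  noise_independent : independent2 P X eps }.

(* l(theta1, theta2) = E[(X theta1 - X theta2)^2], the expectation being over
   [X] only. *)
Definition loss p (X : {RV P >-> p.-tuple R}) (theta1 theta2 : 'cV[R]_p)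
    : \bar R :=
  ('E_P[fun w => ((dotr (X w) theta1 - dotr (X w) theta2) ^+ 2)%R])%E.

End gaussian.

Section replications.
Context {R : realType}.
Context {d0 : measure_display} {T0 : measurableType d0} (P0 : probability T0 R).
Context {d : measure_display} {T : measurableType d} (P : probability T R).

Definition iid_copies n d' (U : measurableType d')
    (Z0 : T0 -> U) (Z : 'I_n -> T -> U) : Prop :=
  (forall a (B : set U), measurable B -> P (Z a @^-1` B) = P0 (Z0 @^-1` B)) /\
  mutually_independent P Z.

(* The observations (Y_a, X_a), a < n, under the parameter [theta]. *)
Definition sample n p (X : 'I_n -> T -> p.-tuple R) (eps : 'I_n -> T -> R)
    (theta : 'cV[R]_p) (w : T) : n.-tuple (R * p.-tuple R) :=
  [tuple (dotr (X a w) theta + eps a w, X a w) | a < n].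

Definition estimator n p : set (n.-tuple (R * p.-tuple R) -> 'cV[R]_p) :=
  [set thetahat | forall i, measurable_fun setT (fun z => thetahat z i 0)].

(* [X0] is the generic covariate vector through which the loss is defined. *)
Definition risk n p (X0 : {RV P0 >-> p.-tuple R})
    (X : 'I_n -> T -> p.-tuple R) (eps : 'I_n -> T -> R)
    (thetahat : n.-tuple (R * p.-tuple R) -> 'cV[R]_p) (theta : 'cV[R]_p)
    : \bar R :=
  (\int[P]_w loss X0 (thetahat (sample X eps theta w)) theta)%E.

Definition minimax_risk n p (X0 : {RV P0 >-> p.-tuple R})
    (X : 'I_n -> T -> p.-tuple R) (eps : 'I_n -> T -> R)
    (Theta : set 'cV[R]_p) : \bar R :=
  ereal_inf [set ereal_sup [set risk X0 X eps thetahat theta | theta in Theta]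
            | thetahat in @estimator n p].

End replications.

(* Main.v *)
(* Fano's method over a sparse code. Cut {1, ..., p} into k blocks of length
   q = p / k and attach to a word w in {1, ..., q}^k the vector rho 1_{S_w},
   where S_w contains the w_i-th element of the i-th block. A Gilbert code of
   size M >= q^(k/8) with Hamming distances > k/8 gives M vectors which, by
   restricted isometry, are separated by (1 - delta)^2 rho^2 k / 8 and at
   distance at most (1 + delta)^2 rho^2 k from 0. Dividing the i-th coordinate
   by sqrt(Sigma_ii) turns Sigma into the correlation matrix; as Sigma_ii >= 1
   it keeps the vectors in the box.

   The events "thetahat is close to theta_j" are disjoint. Under theta_j such an
   event has probability at most sqrt(M) times its probability under theta = 0,
   plus the probability under theta_j that the likelihood ratio exceeds sqrt(M).
   The latter is small because the information n l(theta_j, 0) / sigma^2 is a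
   small multiple of ln M. Averaging over j, some theta_j is missed with
   probability at least 1/10. *)

Require Import Defs.
From HB Require Import structures.
From mathcomp Require Import all_boot all_order all_algebra.
From mathcomp Require Import all_classical all_reals all_analysis.
From mathcomp Require Import measurable_realfun.
From mathcomp Require Import ring lra zify.

Set Implicit Arguments.
Unset Strict Implicit.
Unset Printing Implicit Defensive.

Import Order.TTheory GRing.Theory Num.Theory.
Import numFieldNormedType.Exports.

Local Open Scope classical_set_scope.
Local Open Scope ring_scope.

(** * Equality of weighted laws and products of independent variables *)

Section weighted_integrals.
Local Open Scope ereal_scope.
Context {R : realType} {d} {U : measurableType d}.

Import HBNNSimple.

(** The weight [h] need not be a function of [Z]. Approximating [g] by simple functions and using
    monotone convergence, the integral depends on [Z] and [h] only through the integrals of [h] over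
    preimages under [Z]. *)
Lemma ge0_integral_comp_weight d1 (T : measurableType d1)
    (mu : {measure set T -> \bar R}) (Z : T -> U) (h : T -> R) (g : U -> \bar R)
    (mg : measurable_fun setT g) :
  measurable_fun setT Z -> measurable_fun setT h ->
  (forall x, 0 <= h x)%R -> (forall u, 0 <= g u) ->
  \int[mu]_x (g (Z x) * (h x)%:E) =
  limn (fun n => \sum_(r \in range (nnsfun_approx measurableT mg n))
    r%:E * \int[mu]_(x in Z @^-1` (nnsfun_approx measurableT mg n @^-1` [set r]))
              (h x)%:E).
Proof.
move=> mZ mh h0 g0; set f := nnsfun_approx measurableT mg.
have mhE : measurable_fun setT (EFin \o h) by exact/measurable_EFinP.
have mfZ n : measurable_fun setT (f n \o Z) by exact: measurableT_comp.
have mA n r : measurable (Z @^-1` (f n @^-1` [set r])).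
  rewrite -comp_preimage -[X in measurable X]setTI.
  exact: mfZ.
transitivity (limn (fun n => \int[mu]_x ((f n (Z x))%:E * (h x)%:E))).
  rewrite -monotone_convergence//.
  - apply: eq_integral => x _; apply/esym/cvg_lim => //.
    apply: cvgeZr => //.
    exact: (cvg_nnsfun_approx measurableT mg (fun u _ => g0 u) (x := Z x)).
  - by move=> n; apply: emeasurable_funM => //; apply/measurable_EFinP; exact: mfZ.
  - by move=> n x _; rewrite lee_fin mulr_ge0.
  - move=> x _ m n mn; rewrite lee_fin ler_wpM2r//.
    exact/lefP/nd_nnsfun_approx.
congr (limn _); apply/funext => n.
transitivity (\int[mu]_x (\sum_(r \in range (f n))
    ((r * \1_(Z @^-1` (f n @^-1` [set r])) x)%:E * (h x)%:E))).
  apply: eq_integral => x _.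
  rewrite fimfunE -fsumEFin// ge0_mule_fsuml// => r.
  exact: (nnfun_muleindic_ge0 (f n)).
have pos r x : 0 <= (r * \1_(Z @^-1` (f n @^-1` [set r])) x)%:E * (h x)%:E.
  by rewrite mule_ge0 ?lee_fin//; have := nnfun_muleindic_ge0 (f n) r (Z x).
rewrite ge0_integral_fsum//; last first.
  move=> r; apply: emeasurable_funM => //.
  exact/measurable_EFinP/measurable_funM.
apply: eq_fsbigr => r _.
under eq_integral do rewrite EFinM -muleA.
(* Linearity needs [0 <= r]; a negative [r] is not a value of the nonnegative function [f n], so
   both sides are then zero. *)
have [r0|r0] := leP 0%R r.
  rewrite ge0_integralZl//; first last.
  - by move=> x _; rewrite mule_ge0// lee_fin.
  - by apply: emeasurable_funM => //; exact/measurable_EFinP/measurable_indic.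
  congr (_ * _); rewrite [RHS]integral_mkcond; apply: eq_integral => x _.
  by rewrite epatch_indic muleC.
rewrite (_ : f n @^-1` [set r] = set0) ?preimage_set0 ?integral_set0 ?mule0.
  by rewrite integral0_eq// => x _; rewrite indic0 mul0e mule0.
by apply: preimage_nnfun0.
Qed.

(** With both weights equal to 1 this transfers integrals between variables of equal law; with other
    weights it plays the part of a conditional expectation given [Z]. *)
Lemma ge0_integral_comp_weight_eq d1 (T1 : measurableType d1)
    (mu1 : {measure set T1 -> \bar R}) d2 (T2 : measurableType d2)
    (mu2 : {measure set T2 -> \bar R}) (Z1 : T1 -> U) (Z2 : T2 -> U)
    (h1 : T1 -> R) (h2 : T2 -> R) :
  measurable_fun setT Z1 -> measurable_fun setT h1 -> (forall x, 0 <= h1 x)%R ->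
  measurable_fun setT Z2 -> measurable_fun setT h2 -> (forall x, 0 <= h2 x)%R ->
  (forall B, measurable B ->
    \int[mu1]_(x in Z1 @^-1` B) (h1 x)%:E = \int[mu2]_(x in Z2 @^-1` B) (h2 x)%:E) ->
  forall g : U -> \bar R, measurable_fun setT g -> (forall u, 0 <= g u) ->
  \int[mu1]_x (g (Z1 x) * (h1 x)%:E) = \int[mu2]_x (g (Z2 x) * (h2 x)%:E).
Proof.
move=> mZ1 mh1 h10 mZ2 mh2 h20 E g mg g0.
rewrite (ge0_integral_comp_weight _ mg)// (ge0_integral_comp_weight _ mg)//.
by congr (limn _); apply/funext => n; apply: eq_fsbigr => r _; rewrite E.
Qed.

End weighted_integrals.

Lemma measurable_bigprod (R : realType) d (T : measurableType d) (I : Type)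
    (r : seq I) (Q : pred I) (h : I -> T -> R) :
  (forall i, measurable_fun setT (h i)) ->
  measurable_fun setT (fun x => \prod_(i <- r | Q i) h i x).
Proof.
move=> mh; elim: r => [|i r IHr].
  by under eq_fun do rewrite big_nil; exact: measurable_cst.
under eq_fun do rewrite big_cons; case: (Q i) => //.
exact: measurable_funM.
Qed.

Section independent_products.
Local Open Scope ereal_scope.
Context {R : realType} {d} {T : measurableType d} (P : probability T R).
Context {d'} {U : measurableType d'} {I : finType} (Z : I -> T -> U).
Hypothesis mZ : forall a, measurable_fun setT (Z a).
Hypothesis indZ : mutually_independent P Z.

(** Induction on the number of factors that are not indicators. When all are indicators this is the
    definition of independence; the step frees one factor at a time. *)
Lemma integral_prod_independent (g : I -> U -> R) (c : I -> R) :
  (forall a, measurable_fun setT (g a)) -> (forall a u, 0 <= g a u)%R ->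
  (forall a, \int[P]_w (g a (Z a w))%:E = (c a)%:E) ->
  \int[P]_w (\prod_a g a (Z a w))%R%:E = (\prod_a c a)%R%:E.
Proof.
have main (F : {set I}) : forall (g : I -> U -> R) (c : I -> R),
  (forall a, measurable_fun setT (g a)) -> (forall a u, 0 <= g a u)%R ->
  (forall a, \int[P]_w (g a (Z a w))%:E = (c a)%:E) ->
  (forall a, a \notin F -> exists2 B, measurable B & g a = \1_B) ->
  \int[P]_w (\prod_a g a (Z a w))%R%:E = (\prod_a c a)%R%:E.
  clear g c; move: {2}#|F| (erefl #|F|) => m; elim: m F => [|m IH] F.
    move/eqP; rewrite cards_eq0 => /eqP -> g c mg g0 gc gB.
    have {}gB a : {B | measurable B & g a = \1_B}.
      by apply/cid2/gB; rewrite inE.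
    pose B a := s2val (gB a).
    have mB a : measurable (B a) by exact: (s2valP (gB a)).
    have gBE a : g a = \1_(B a) by exact: (s2valP' (gB a)).
    have mZB a : measurable (Z a @^-1` B a).
      by rewrite -[X in measurable X]setTI; exact: mZ.
    have cE a : (c a)%:E = P (Z a @^-1` B a).
      rewrite -gc gBE; transitivity (\int[P]_w (\1_(Z a @^-1` B a) w)%:E) => //.
      by rewrite integral_indic// setIT.
    rewrite -prodEFin; under eq_bigr do rewrite cE.
    have H := indZ [set: I]%SET mB.
    rewrite (eq_bigl predT) in H; last by move=> a; rewrite inE.
    rewrite -H -[X in _ = P X]setIT -integral_indic//.
      apply: eq_integral => w _; congr EFin; rewrite indicE.
      have [wB|wB] := boolP (w \in _).
        rewrite big1// => a _; rewrite gBE indicE.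
        by move: wB; rewrite inE => /(_ a) wBa; rewrite mem_set//; apply: wBa; rewrite /= inE.
      apply/eqP/prodf_eq0; move: wB; rewrite notin_setE /bigcap /= => /existsNP[a].
      move=> /not_implyP[_ wa]; exists a => //; rewrite gBE indicE memNset//.
    by apply: fin_bigcap_measurable => // a _; exact: mZB.
  move=> cF g c mg g0 gc gB.
  have [b bF] : exists b, b \in F by apply/set0Pn; rewrite -cards_eq0 cF.
  have cF' : #|F :\ b| = m by move: cF; rewrite (cardsD1 b F) bF => -[].
  pose h w := (\prod_(a | a != b) g a (Z a w))%R.
  pose C := (\prod_(a | a != b) c a)%R.
  have c0 a : (0 <= c a)%R.
    by rewrite -lee_fin -gc integral_ge0// => w _; rewrite lee_fin.
  have C0 : (0 <= C)%R by apply: prodr_ge0.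
  have mh : measurable_fun setT h.
    by apply: measurable_bigprod => a; exact: measurableT_comp.
  have h0 w : (0 <= h w)%R by apply: prodr_ge0.
  have E B : measurable B ->
      \int[P]_(w in Z b @^-1` B) (h w)%:E = \int[P]_(w in Z b @^-1` B) (cst C w)%:E.
    move=> mB.
    have mZB : measurable (Z b @^-1` B).
      by rewrite -[X in measurable X]setTI; exact: mZ.
    (* With the factor at [b] replaced by an indicator, the induction hypothesis applies. It shows
       that the product [h] of the other factors weighs the law of [Z b] exactly as its mean [C]
       does, whence [g b] can be put back. *)
    pose g' a := if a == b then \1_B else g a.
    pose c' a := if a == b then fine (P (Z b @^-1` B)) else c a.
    have H : \int[P]_w (\prod_a g' a (Z a w))%R%:E = (\prod_a c' a)%R%:E.
      apply: (IH _ cF').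
      - by move=> a; rewrite /g'; case: ifP => // _; exact: measurable_indic.
      - by move=> a u; rewrite /g'; case: ifP => // _; rewrite indicE.
      - move=> a; rewrite /g' /c'; case: ifP => // /eqP ->.
        by rewrite fineK ?fin_num_measure// -[X in _ = P X]setIT -integral_indic.
      - move=> a; rewrite !inE negb_and negbK /g'; case: eqP => [_ _|_ /= aF].
          by exists B.
        exact: gB.
    rewrite (bigD1 b)//= {1}/c' eqxx in H.
    rewrite (eq_bigr c) in H; last by move=> a ab; rewrite /c' (negbTE ab).
    rewrite -/C in H.
    transitivity (fine (P (Z b @^-1` B)) * C)%:E; last first.
      by rewrite (integral_cst P mZB C%:E) EFinM fineK ?fin_num_measure// muleC.
    rewrite -H.
    rewrite integral_mkcond; apply: eq_integral => w _.
    rewrite epatch_indic -EFinM (bigD1 b)//= {1}/g' eqxx mulrC.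
    congr (_ * _)%:E; apply: eq_bigr => a ab.
    by rewrite /g' (negbTE ab).
  transitivity (\int[P]_w ((EFin \o g b) (Z b w) * (h w)%:E)).
    by apply: eq_integral => w _; rewrite (bigD1 b)//= EFinM.
  rewrite (ge0_integral_comp_weight_eq (mZ b) mh h0 (mZ b) (h2 := cst C) _ _ E)//.
  - rewrite /= ge0_integralZr//=; last first.
    + by move=> w _; rewrite lee_fin.
    + by apply/measurable_EFinP; exact: measurableT_comp.
    by rewrite gc -EFinM [in RHS](bigD1 b).
  - exact/measurable_EFinP.
  - by move=> u /=; rewrite lee_fin.
by move=> mg g0 gc; apply: (main [set: I]%SET) => // a; rewrite inE.
Qed.

End independent_products.

(** * Gaussian shifts and the likelihood of the sample *)

Lemma lebesgue_measure_shift (R : realType) (c : R) (A : set R) :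
  measurable A ->
  pushforward lebesgue_measure ((fun x => x + c) : R -> measurableTypeR R) A =
  lebesgue_measure A :> \bar R.
Proof.
move=> mA; apply/esym/lebesgue_measure_unique => //=.
  exact: measurable_funD.
move=> _ _ [[a b]] _ <-.
rewrite /pushforward /=.
rewrite (_ : _ @^-1` _ = `]a - c, b - c]%classic); last first.
  by apply/seteqP; split => x /=; rewrite !in_itv/= ltrBlDr lerBrDr.
by rewrite !lebesgue_measure_itv/= !lte_fin ltrD2r; case: ifP => // _; congr EFin; ring.
Qed.

Section gaussian_shift.
Local Open Scope ereal_scope.
Context {R : realType}.

(** The density at [y] of N(c, s^2) with respect to N(0, s^2). *)
Definition likelihood_ratio (s c y : R) : R :=
  expR (y * c / s ^+ 2 - c ^+ 2 / (s ^+ 2 *+ 2)).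

Lemma measurable_likelihood_ratio d (T : measurableType d) (s : R) (c y : T -> R) :
  measurable_fun setT c -> measurable_fun setT y ->
  measurable_fun setT (fun t => likelihood_ratio s (c t) (y t)).
Proof.
move=> mc my; apply: measurableT_comp => //; apply: measurable_funB.
  by apply: measurable_funM => //; exact: measurable_funM.
by apply: measurable_funM => //; exact: measurable_funX.
Qed.

Lemma integral_normal_prob (m s : R) (g : R -> \bar R) :
  measurable_fun setT g -> (forall y, 0 <= g y) ->
  \int[normal_prob m s]_y g y =
  \int[lebesgue_measure]_y (g y * (normal_pdf m s y)%:E).
Proof.
move=> mg g0.
transitivity (\int[normal_prob m s]_y (g y * (cst 1%R y)%:E)).
  by apply: eq_integral => y _; rewrite mule1.
apply: (ge0_integral_comp_weight_eq (Z1 := id) (Z2 := id)) => //.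
- exact: measurable_normal_pdf.
- by move=> y; exact: normal_pdf_ge0.
- by move=> B mB; rewrite (integral_cst (normal_prob m s) mB 1) mul1e.
Qed.

(** Translation invariance of Lebesgue measure moves the shift onto the Gaussian density, and
    completing the square turns the shifted density into the likelihood ratio times the centred
    one. *)
Lemma normal_prob_shift (s c : R) (B : set R) : s != 0%R -> measurable B ->
  normal_prob 0%R s [set y | B (y + c)%R] =
  \int[normal_prob 0%R s]_(y in B) (likelihood_ratio s c y)%:E.
Proof.
move=> s0 mB.
have ml : measurable_fun setT (likelihood_ratio s c).
  exact: (measurable_likelihood_ratio s (c := cst c) (y := id)).
have mpdf := measurable_normal_pdf (R := R).
have mc : measurable_fun setT ((fun x => (x + c)%R) : R -> measurableTypeR R).
  exact: measurable_funD.
rewrite [RHS]integral_mkcond integral_normal_prob; first last.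
- by move=> y; rewrite /patch; case: ifP => //; rewrite lee_fin expR_ge0.
- apply/(measurable_restrictT _ _).1 => //.
  by apply: measurable_funTS; exact/measurable_EFinP.
transitivity (\int[lebesgue_measure]_y ((\1_B y)%:E * (normal_pdf 0%R s (y - c))%:E)).
  rewrite (eq_measure_integral (pushforward lebesgue_measure
    ((fun x => (x + c)%R) : R -> measurableTypeR R))); last first.
    by move=> A mA _; exact/esym/lebesgue_measure_shift.
  rewrite ge0_integral_pushforward//=.
  - rewrite /normal_prob integral_mkcond; apply: eq_integral => y _ /=.
    by rewrite epatch_indic addrK muleC.
  - apply: emeasurable_funM.
      by apply/measurable_EFinP; exact: measurable_indic.
    apply/measurable_EFinP; apply: measurableT_comp; first exact: mpdf.
    exact: measurable_funB.
  - by move=> y _; rewrite mule_ge0 ?lee_fin// normal_pdf_ge0.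
apply: eq_integral => y _.
rewrite epatch_indic -!EFinM; congr EFin.
rewrite [RHS]mulrAC [RHS]mulrC; congr (_ * _)%R.
rewrite !normal_pdfE// /normal_fun /likelihood_ratio mulrCA -expRD; congr (_ * expR _)%R.
by rewrite !subr0; field.
Qed.

End gaussian_shift.

Lemma dotrE (R : realType) p (x : p.-tuple R) (theta : 'cV[R]_p) :
  dotr x theta = \sum_j tnth x j * theta j 0.
Proof. by rewrite /dotr mxE; apply: eq_bigr => j _; rewrite mxE. Qed.

Lemma dotrZr (R : realType) p (x : p.-tuple R) (a : R) (theta : 'cV[R]_p) :
  dotr x (a *: theta) = a * dotr x theta.
Proof. by rewrite /dotr -scalemxAr mxE. Qed.

Lemma measurable_dotr (R : realType) p (theta : 'cV[R]_p) d
    (T : measurableType d) (X : T -> p.-tuple R) :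
  measurable_fun setT X -> measurable_fun setT (fun w => dotr (X w) theta).
Proof.
move=> mX; under eq_fun do rewrite dotrE.
apply: measurable_sum => j; apply: measurable_funM => //.
exact: (measurableT_comp (measurable_tnth j)).
Qed.

Section one_observation.
Local Open Scope ereal_scope.
Context {R : realType} {d} {T : measurableType d} (P : probability T R) {p : nat}.
Variables (X : {RV P >-> p.-tuple R}) (eps : {RV P >-> R}) (s : R).
Hypothesis s0 : s != 0%R.
Hypothesis neps : normal_law P eps 0 s.
Hypothesis indXe : independent2 P X eps.

(** Independence is stated on rectangles only; uniqueness of the product measure extends it to all
    measurable sets, which makes Fubini available. *)
Lemma joint_law_noise (S : set (p.-tuple R * R)) : measurable S ->
  (distribution P X \x distribution P eps) S = P [set w | S (X w, eps w)].
Proof.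
move=> mS.
have mXe : measurable_fun setT (fun w => (X w, eps w)).
  by apply: measurable_fun_pair.
pose XE : {mfun T >-> (p.-tuple R * R)%type} :=
  HB.pack (fun w => (X w, eps w)) (isMeasurableFun.Build _ _ _ _ _ mXe).
apply: (product_measure_unique (m1 := distribution P X)
  (m2 := distribution P eps) (m' := distribution P XE)).
  by move=> A B mA mB; exact: indXe.
exact: mS.
Qed.

Lemma noise_shift (c : R) (B : set R) : measurable B ->
  P [set w | B (eps w + c)%R] =
  \int[distribution P eps]_(y in B) (likelihood_ratio s c y)%:E.
Proof.
move=> mB.
have ml : measurable_fun setT (fun y => (likelihood_ratio s c y)%:E).
  apply/measurable_EFinP.
  exact: (measurable_likelihood_ratio s (c := cst c) (y := id)).
have mc : measurable [set y | B (y + c)%R].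
  rewrite -[X in measurable X]setTI.
  have mf : measurable_fun setT (fun y : R => (y + c)%R).
    exact: measurable_funD.
  exact: mf.
transitivity (normal_prob 0%R s [set y | B (y + c)%R]).
  by have := neps mc; rewrite (negbTE s0).
rewrite normal_prob_shift// integral_mkcond [RHS]integral_mkcond.
set g := _ \_ B.
transitivity (\int[normal_prob 0%R s]_y (g y * (cst 1%R y)%:E)).
  by apply: eq_integral => y _; rewrite mule1.
transitivity (\int[distribution P eps]_y (g y * (cst 1%R y)%:E)); last first.
  by apply: eq_integral => y _; rewrite mule1.
apply: (ge0_integral_comp_weight_eq (mu1 := normal_prob 0%R s)
  (mu2 := distribution P eps) (Z1 := (id : measurableTypeR R -> R)) (Z2 := id)
  (h1 := cst 1%R) (h2 := cst 1%R)) => //.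
- move=> A mA; rewrite (integral_cst (normal_prob 0%R s) mA 1).
  rewrite (integral_cst (distribution P eps) mA 1).
  by congr (_ * _); have := neps mA; rewrite (negbTE s0).
- by apply/(measurable_restrictT _ _).1 => //; apply: measurable_funTS.
- by move=> y; rewrite /g /patch; case: ifP => // _; rewrite lee_fin expR_ge0.
Qed.

(** By Fubini the covariates can be frozen at [x]; the response is then the noise translated by
    [dotr x theta], and [noise_shift] applies to each slice. Under the parameter 0 the response is
    the noise itself. *)
Lemma one_observation_shift (theta : 'cV[R]_p) (B : set (R * p.-tuple R)) :
  measurable B ->
  P [set w | B (dotr (X w) theta + eps w, X w)%R] =
  \int[P]_(w in [set w | B (eps w, X w)])
    (likelihood_ratio s (dotr (X w) theta) (eps w))%:E.
Proof.
move=> mB.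
have mdot : measurable_fun setT (fun z : p.-tuple R * R => dotr z.1 theta).
  exact: measurable_dotr.
pose S1 := [set z : p.-tuple R * R | B (dotr z.1 theta + z.2, z.1)%R].
have mS1 : measurable S1.
  rewrite -[X in measurable X]setTI.
  have mf : measurable_fun setT
      (fun z : p.-tuple R * R => (dotr z.1 theta + z.2, z.1)%R).
    by apply: measurable_fun_pair => //; exact: measurable_funD.
  exact: mf.
pose S2 := [set z : p.-tuple R * R | B (z.2, z.1)].
have mS2 : measurable S2.
  rewrite -[X in measurable X]setTI.
  have mf : measurable_fun setT (fun z : p.-tuple R * R => (z.2, z.1)).
    by apply: measurable_fun_pair.
  exact: mf.
pose l (z : p.-tuple R * R) := (likelihood_ratio s (dotr z.1 theta) z.2)%:E.
have ml : measurable_fun setT (l \_ S2).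
  apply/(measurable_restrictT _ _).1 => //; apply: measurable_funTS.
  by apply/measurable_EFinP; exact: measurable_likelihood_ratio.
have l0 z : 0 <= (l \_ S2) z.
  by rewrite /patch; case: ifP => // _; rewrite lee_fin expR_ge0.
have mXe : measurable_fun setT (fun w => (X w, eps w)).
  by apply: measurable_fun_pair.
transitivity ((distribution P X \x distribution P eps) S1).
  by rewrite joint_law_noise.
transitivity (\int[distribution P X \x distribution P eps]_z (l \_ S2) z).
  rewrite fubini_tonelli1//; apply: eq_integral => x _.
  rewrite /fubini_F /=.
  have mB2 : measurable [set y | B (y, x)].
    by have := measurable_ysection x mB; rewrite /ysection; under eq_set do rewrite inE.
  transitivity (distribution P eps [set y | [set y | B (y, x)] (y + dotr x theta)%R]).
    congr (distribution _ _ _); apply/seteqP.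
    by split => y; rewrite /xsection /= inE /S1 /= addrC.
  rewrite [LHS]noise_shift// integral_mkcond; apply: eq_integral => y _.
  by [].
pose XE : {mfun T >-> (p.-tuple R * R)%type} :=
  HB.pack (fun w => (X w, eps w)) (isMeasurableFun.Build _ _ _ _ _ mXe).
rewrite (eq_measure_integral (distribution P XE)); last first.
  by move=> A mA _; exact: joint_law_noise.
rewrite ge0_integral_distribution// [RHS]integral_mkcond.
by apply: eq_integral => w _; [].
Qed.

End one_observation.

Section tuple_rectangles.
Context {d} {T : measurableType d} {n : nat}.

Definition rectangle (B : 'I_n -> set T) : set (n.-tuple T) :=
  [set z | forall a, B a (tnth z a)].

Definition rectangles : set (set (n.-tuple T)) :=
  [set rectangle B | B in [set B | forall a, measurable (B a)]].

Lemma measurable_rectangle (B : 'I_n -> set T) :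
  (forall a, measurable (B a)) -> measurable (rectangle B).
Proof.
move=> mB; rewrite (_ : rectangle B =
    \bigcap_(a in setT) ((fun z => tnth z a) @^-1` B a)); last first.
  by apply/seteqP; split => z /= H a => [_|]; exact: H.
apply: fin_bigcap_measurable => // a _.
by rewrite -[X in measurable X]setTI; exact: (measurable_tnth a).
Qed.

Lemma setI_closed_rectangles : setI_closed rectangles.
Proof.
move=> _ _ [B mB <-] [C mC <-]; exists (fun a => B a `&` C a).
  by move=> a; exact: measurableI.
by apply/seteqP; split => z /= => [H|[H1 H2] a]; split => // a; case: (H a).
Qed.

(** A preimage under one coordinate is the rectangle whose other sides are the full space, so the
    generators of the product sigma-algebra are rectangles. *)
Lemma measurable_tuple_rectangles : @measurable _ (n.-tuple T) = <<s rectangles >>.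
Proof.
apply/seteqP; split.
- apply: smallest_sub; first exact: smallest_sigma_algebra.
  move=> A; rewrite -bigcup_seq/= => -[i _ [B mB <-]].
  apply: sub_sigma_algebra; rewrite setTI.
  exists (fun a => if a == i then B else setT).
    by move=> a /=; case: ifP.
  apply/seteqP; split => z /= H => [|a]; first by have := H i; rewrite eqxx.
  by case: eqP => // ->.
- apply: smallest_sub; first exact: sigma_algebra_measurable.
  by move=> _ [B mB <-]; exact: measurable_rectangle.
Qed.

Lemma measure_tuple_unique (R : realType)
    (m1 : probability (n.-tuple T) R) (m2 : {measure set (n.-tuple T) -> \bar R}) :
  (forall B : 'I_n -> set T, (forall a, measurable (B a)) ->
    m1 (rectangle B) = m2 (rectangle B)) ->
  forall A, measurable A -> m1 A = m2 A.
Proof.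
move=> E A mA; apply: (measure_unique rectangles (fun=> setT)) => //.
- exact: measurable_tuple_rectangles.
- exact: setI_closed_rectangles.
- by move=> _; exists (fun=> setT) => //; apply/seteqP; split.
- exact: bigcup_const.
- by move=> _ [B mB <-]; exact: E.
- by move=> _; apply: (le_lt_trans (probability_le1 _ _)) => //; rewrite ltry.
Qed.

End tuple_rectangles.

Section weighted_measure.
Local Open Scope ereal_scope.
Context {R : realType} d (T : measurableType d) (mu : {measure set T -> \bar R}).
Variable h : T -> R.
Hypotheses (mh : measurable_fun setT h) (h0 : forall x, (0 <= h x)%R).

(** The measure with density [h]. It receives a measure structure so that the right-hand side of the
    change of measure can enter the uniqueness theorem on tuples. *)
Definition weighted_measure (A : set T) := \int[mu]_(x in A) (h x)%:E.

Let weighted0 : weighted_measure set0 = 0.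
Proof. by rewrite /weighted_measure integral_set0. Qed.

Let weighted_ge0 A : 0 <= weighted_measure A.
Proof. by apply: integral_ge0 => x _; rewrite lee_fin. Qed.

Let weighted_sigma_additive : semi_sigma_additive weighted_measure.
Proof.
move=> F mF tF mUF; rewrite [X in _ --> X](_ : _ =
    \sum_(n <oo) weighted_measure (F n)); last first.
  rewrite /weighted_measure ge0_integral_bigcup//.
  - by apply: measurable_funTS; exact/measurable_EFinP.
  - by move=> x _; rewrite lee_fin.
by apply: is_cvg_ereal_nneg_natsum => n _; exact: weighted_ge0.
Qed.

HB.instance Definition _ := isMeasure.Build _ _ _
  weighted_measure weighted0 weighted_ge0 weighted_sigma_additive.

Definition weighted : {measure set T -> \bar R} := weighted_measure.

End weighted_measure.

Section sample_shift.
Local Open Scope ereal_scope.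
Context {R : realType} {d} {T : measurableType d} (P : probability T R) {n p : nat}.
Variables (X : 'I_n -> {RV P >-> p.-tuple R}) (eps : 'I_n -> {RV P >-> R}) (s : R).
Hypothesis s0 : s != 0%R.
Hypothesis neps : forall a, normal_law P (eps a) 0 s.
Hypothesis indXe : forall a, independent2 P (X a) (eps a).
Hypothesis indobs : mutually_independent P (fun a w => (X a w, eps a w)).

(** The likelihood ratio of [theta] against 0, evaluated at the sample generated under 0, whose
    responses are the noises. *)
Definition sample_likelihood (theta : 'cV[R]_p) (w : T) : R :=
  \prod_a likelihood_ratio s (dotr (X a w) theta) (eps a w).

Lemma measurable_sample_likelihood theta :
  measurable_fun setT (sample_likelihood theta).
Proof.
apply: measurable_bigprod => a; apply: measurable_likelihood_ratio => //.
exact: measurable_dotr.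
Qed.

Lemma measurable_sample theta : measurable_fun setT (sample X eps theta).
Proof.
apply/measurable_fun_tnthP => a /=.
rewrite [X in measurable_fun _ X](_ : _ =
    fun w => (dotr (X a w) theta + eps a w, X a w)%R); last first.
  by apply/funext => w /=; rewrite tnth_mktuple.
by apply: measurable_fun_pair => //; apply: measurable_funD => //; exact: measurable_dotr.
Qed.

Lemma measurable_sample_preimage theta (B : set (n.-tuple (R * p.-tuple R))) :
  measurable B -> measurable (sample X eps theta @^-1` B).
Proof. by move=> mB; rewrite -[X in measurable X]setTI; exact: measurable_sample. Qed.

(** Both sides are measures of [B], hence it suffices to compare them on rectangles. There
    independence of the observations factors each side, and the factors agree by
    [one_observation_shift]. *)
Lemma sample_shift theta (B : set (n.-tuple (R * p.-tuple R))) : measurable B ->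
  P (sample X eps theta @^-1` B) =
  \int[P]_(w in sample X eps 0 @^-1` B) (sample_likelihood theta w)%:E.
Proof.
move=> mB.
have sample_rect t C : sample X eps t @^-1` rectangle C =
    \bigcap_(a in setT) [set w | C a (dotr (X a w) t + eps a w, X a w)%R].
  apply/seteqP; split => w /= H a => [_|]; first by have := H a; rewrite tnth_mktuple.
  by rewrite tnth_mktuple; exact: H.
pose S t : {mfun T >-> n.-tuple (R * p.-tuple R)} :=
  HB.pack (sample X eps t) (isMeasurableFun.Build _ _ _ _ _ (measurable_sample t)).
have L0 w : (0 <= sample_likelihood theta w)%R.
  by apply: prodr_ge0 => a _; exact: expR_ge0.
pose Q := weighted P (measurable_sample_likelihood theta) L0.
have mS0 : measurable_fun setT (sample X eps 0) by exact: measurable_sample.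
apply: (measure_tuple_unique (m1 := distribution P (S theta))
  (m2 := pushforward Q (sample X eps 0))) => //.
move=> C mC.
have mpair : forall a, measurable_fun setT (fun w => (X a w, eps a w)).
  by move=> a; exact: measurable_fun_pair.
transitivity (P (sample X eps theta @^-1` rectangle C)) => //.
transitivity (\int[P]_(w in sample X eps 0 @^-1` rectangle C)
  (sample_likelihood theta w)%:E) => //.
have mdot t : measurable_fun setT (fun z : p.-tuple R * R => dotr z.1 t).
  exact: measurable_dotr.
pose D t a := [set z : p.-tuple R * R | C a (dotr z.1 t + z.2, z.1)%R].
have mD t a : measurable (D t a).
  rewrite -[X in measurable X]setTI.
  have mf : measurable_fun setT
      (fun z : p.-tuple R * R => (dotr z.1 t + z.2, z.1)%R).
    by apply: measurable_fun_pair => //; exact: measurable_funD.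
  exact: mf.
pose c a := fine (P [set w | C a (dotr (X a w) theta + eps a w, X a w)%R]).
have mC' t a : measurable [set w | C a (dotr (X a w) t + eps a w, X a w)%R].
  have := mpair a measurableT _ (mD t a); rewrite setTI; exact.
have cE a : (c a)%:E = P [set w | C a (dotr (X a w) theta + eps a w, X a w)%R].
  by rewrite /c fineK ?fin_num_measure.
rewrite sample_rect.
have H := indobs [set: 'I_n]%SET (mD theta).
rewrite (eq_bigr (fun a => (c a)%:E)) in H; last by move=> a _; rewrite cE.
rewrite (eq_bigl predT) in H; last by move=> a; rewrite inE.
rewrite prodEFin in H.
transitivity (\prod_a c a)%R%:E.
  rewrite -H; congr (P _); apply/seteqP; split => w /= Hw a _; first exact: Hw.
  by apply: Hw => //=; rewrite inE.
(* The indicator of the rectangle is a product too, so it is absorbed into the factors before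
   independence is applied. *)
pose g a (z : p.-tuple R * R) :=
  (\1_(D 0 a) z * likelihood_ratio s (dotr z.1 theta) z.2)%R.
rewrite -(integral_prod_independent mpair indobs (g := g)).
- rewrite [RHS]integral_mkcond; apply: eq_integral => w _.
  rewrite /patch sample_rect /g big_split/=; case: ifPn => wC.
    rewrite big1 ?mul1r// => a _; rewrite indicE mem_set//.
    by move: wC; rewrite inE => /(_ a I).
  suff -> : (\prod_a (\1_(D 0 a) (X a w, eps a w) : R) = 0)%R by rewrite mul0r.
  apply/eqP/prodf_eq0; move: wC; rewrite notin_setE => /existsNP[a].
  by move=> /not_implyP[_ wa]; exists a => //; rewrite indicE memNset.
- move=> a; apply: measurable_funM; first exact: measurable_indic.
  exact: measurable_likelihood_ratio.
- by move=> a z; rewrite mulr_ge0 ?expR_ge0// indicE.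
- move=> a; rewrite cE (one_observation_shift s0 (neps a) (indXe a))//.
  rewrite [RHS]integral_mkcond; apply: eq_integral => w _.
  have dot0 (x : p.-tuple R) : dotr x 0 = 0%R by rewrite /dotr mulmx0 mxE.
  rewrite /patch /g indicE /D; case: ifPn => wC.
    rewrite mem_set ?mul1r//= dot0 add0r.
    by rewrite inE in wC.
  rewrite memNset ?mul0r//= dot0 add0r.
  by rewrite notin_setE in wC.
Qed.

End sample_shift.

(** * Tails of the log-likelihood ratio and comparison with the null parameter *)

Lemma ge0_markov (R : realType) d (T : measurableType d) (P : probability T R)
    (f : T -> R) (a b : R) :
  measurable_fun setT f -> (forall x, 0 <= f x) -> 0 < a ->
  (\int[P]_x (f x)%:E <= b%:E)%E ->
  (P [set x | (a <= f x)%R] <= (b / a)%:E)%E.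
Proof.
move=> mf f0 a0 fb.
rewrite EFinM lee_pdivlMr// muleC; apply: le_trans fb.
have mfE : measurable_fun setT (EFin \o f) by exact/measurable_EFinP.
have := le_integral_abse P measurableT mfE a0.
rewrite setTI (_ : [set x | _] = [set x | a <= f x]); last first.
  by apply/seteqP; split => x /=; rewrite lee_fin ger0_norm.
by under eq_integral do rewrite /= ger0_norm//.
Qed.

Section likelihood_test.
Local Open Scope ereal_scope.
Context {R : realType} {d} {T : measurableType d} (P : probability T R) {n p : nat}.
Variables (X : 'I_n -> {RV P >-> p.-tuple R}) (eps : 'I_n -> {RV P >-> R}) (s : R).
Hypothesis s0 : s != 0%R.
Hypothesis neps : forall a, normal_law P (eps a) 0 s.
Hypothesis indXe : forall a, independent2 P (X a) (eps a).
Hypothesis indobs : mutually_independent P (fun a w => (X a w, eps a w)).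

(** [Zs - Ws / 2] is the logarithm of [sample_likelihood]. Given the covariates, [Zs] is centred
    Gaussian with variance [Ws]. *)
Let Zs theta (w : T) : R := (\sum_a eps a w * dotr (X a w) theta / s ^+ 2)%R.
Let Ws theta (w : T) : R := (\sum_a (dotr (X a w) theta / s) ^+ 2)%R.

Let mdot theta a : measurable_fun setT (fun w => dotr (X a w) theta).
Proof. exact: measurable_dotr. Qed.

Let mZs theta : measurable_fun setT (Zs theta).
Proof.
apply: measurable_sum => a; apply: measurable_funM => //.
exact: measurable_funM.
Qed.

Let mWs theta : measurable_fun setT (Ws theta).
Proof.
by apply: measurable_sum => a; apply: measurable_funX; apply: measurable_funM.
Qed.

Let Ws_ge0 theta w : (0 <= Ws theta w)%R.
Proof. by apply: sumr_ge0 => a _; exact: sqr_ge0. Qed.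

Let likelihoodE theta w :
  sample_likelihood X eps s theta w = expR (Zs theta w - Ws theta w / 2).
Proof.
rewrite /sample_likelihood /Zs /Ws mulr_suml -sumrB expR_sum.
by apply: eq_bigr => a _; congr expR; field.
Qed.

Let likelihoodZE (t : R) theta w : sample_likelihood X eps s (t *: theta) w =
  expR (t * (Zs theta w - t * Ws theta w / 2)).
Proof.
rewrite likelihoodE /Zs /Ws mulrBr !mulr_sumr !mulr_suml mulr_sumr -!sumrB.
by congr expR; apply: eq_bigr => a _; rewrite !dotrZr; field.
Qed.

Lemma integral_sample_likelihood theta :
  \int[P]_w (sample_likelihood X eps s theta w)%:E = 1.
Proof.
have := sample_shift s0 neps indXe indobs theta measurableT.
by rewrite !preimage_setT probability_setT => <-.
Qed.

(* Under [P] the log-likelihood ratio of the sample with parameter [theta] is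
   [Zs + Ws / 2]; it is large only if [Zs - t * Ws / 2] is, which has an
   exponential moment by the change of measure at [t *: theta], or if [Ws] is. *)
Lemma log_likelihood_tail theta (u t nu : R) : (0 < u)%R -> (0 < t)%R ->
  \int[P]_w (Ws theta w)%:E <= nu%:E ->
  P [set w | (u <= Zs theta w + Ws theta w / 2)%R] <=
  (expR (- (t * u / 2)) + (t + 1) * nu / u)%:E.
Proof.
move=> u0 t0 Wnu.
pose E1 := [set w | (expR (t * u / 2) <= sample_likelihood X eps s (t *: theta) w)%R].
(* The threshold is such that outside [E2] one has [Zs - t * Ws / 2 >= u - (t + 1) * Ws / 2 > u /
   2], which is the event [E1] after exponentiation. *)
pose E2 := [set w | (u / (t + 1) <= Ws theta w)%R].
have mle (f : T -> R) (a : R) : measurable_fun setT f ->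
    measurable [set w | (a <= f w)%R].
  move=> mf; rewrite (_ : [set w | _] = f @^-1` `[a, +oo[); last first.
    by apply/seteqP; split => w /=; rewrite in_itv/= andbT.
  by rewrite -[X in measurable X]setTI; exact: mf.
have mL : measurable_fun setT (sample_likelihood X eps s (t *: theta)).
  exact: measurable_sample_likelihood.
have mE1 : measurable E1 by exact: mle.
have mE2 : measurable E2 by exact: mle.
apply: (@le_trans _ _ (P (E1 `|` E2))).
  apply: le_measure; rewrite ?inE//.
  - apply: mle; apply: measurable_funD => //; exact: measurable_funM.
  - exact: measurableU.
  - move=> w /= uw; have [?|W_lt] := leP (u / (t + 1))%R (Ws theta w); first by right.
    left; rewrite /E1 /= likelihoodZE ler_expR.
    rewrite -mulrA ler_pM2l//.
    have t1 : (0 < t + 1)%R by rewrite addr_gt0.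
    have {}W_lt : ((t + 1) * Ws theta w < u)%R by rewrite mulrC -ltr_pdivlMr.
    lra.
apply: (le_trans (measureU2 _ _ _)) => //.
rewrite EFinD; apply: leeD.
- rewrite expRN -[X in X%:E]mul1r; apply: ge0_markov => //.
  + by move=> w; apply: prodr_ge0 => a _; exact: expR_ge0.
  + exact: expR_gt0.
  + by rewrite integral_sample_likelihood.
- rewrite (_ : (_ / u = nu / (u / (t + 1)))%R); last first.
    by field; rewrite !gt_eqF// addr_gt0.
  apply: ge0_markov => //; rewrite divr_gt0// addr_gt0//.
Qed.

(** Cut [A] according to whether the log-likelihood ratio is below [u]. On the lower part the change
    of measure costs at most a factor [expR u]; the upper part is controlled by
    [log_likelihood_tail]. *)
Lemma likelihood_test_bound theta (u t nu : R) (A : set (n.-tuple (R * p.-tuple R))) :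
  (0 < u)%R -> (0 < t)%R -> measurable A ->
  \int[P]_w (\sum_a (dotr (X a w) theta / s) ^+ 2)%R%:E <= nu%:E ->
  P (sample X eps theta @^-1` A) <=
  (expR u)%:E * P (sample X eps 0 @^-1` A) +
  (expR (- (t * u / 2)) + (t + 1) * nu / u)%:E.
Proof.
move=> u0 t0 mA Wnu.
(* The log-likelihood ratio is written as a function of the observations, so that the truncated [A1]
   is an event of the sample space. On the sample it equals [Zs + Ws / 2] under [theta] and
   [Zs - Ws / 2] under 0. *)
pose ll (z : n.-tuple (R * p.-tuple R)) : R := (\sum_a
  ((tnth z a).1 * dotr (tnth z a).2 theta / s ^+ 2 -
   (dotr (tnth z a).2 theta / s) ^+ 2 / 2))%R.
have ll_sample t' w : ll (sample X eps t' w) =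
    (\sum_a (dotr (X a w) t' * dotr (X a w) theta / s ^+ 2) +
     Zs theta w - Ws theta w / 2)%R.
  rewrite /ll /Zs /Ws mulr_suml -big_split -sumrB/=; apply: eq_bigr => a _.
  by rewrite tnth_mktuple/=; ring.
have mll : measurable_fun setT ll.
  have mz a : measurable_fun setT (fun z : n.-tuple (R * p.-tuple R) => tnth z a).
    exact: measurable_tnth.
  have mz1 a : measurable_fun setT (fun z : n.-tuple (R * p.-tuple R) => (tnth z a).1).
    exact: measurableT_comp.
  have mz2 a : measurable_fun setT
      (fun z : n.-tuple (R * p.-tuple R) => dotr (tnth z a).2 theta).
    by apply: measurable_dotr; exact: measurableT_comp.
  apply: measurable_sum => a; apply: measurable_funB.
    by apply: measurable_funM => //; exact: measurable_funM.
  by apply: measurable_funM => //; apply: measurable_funX; exact: measurable_funM.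
pose A1 := A `&` [set z | (ll z < u)%R].
have mA1 : measurable A1.
  apply: measurableI => //.
  rewrite (_ : [set z | _] = ll @^-1` `]-oo, u[); last first.
    by apply/seteqP; split => z /=; rewrite in_itv.
  by rewrite -[X in measurable X]setTI; exact: mll.
have mpre t' B : measurable B -> measurable (sample X eps t' @^-1` B).
  by move=> mB; exact: measurable_sample_preimage.
have mtail : measurable [set w | (u <= Zs theta w + Ws theta w / 2)%R].
  rewrite (_ : [set w | _] = (fun w => (Zs theta w + Ws theta w / 2)%R) @^-1` `[u, +oo[);
    last by apply/seteqP; split => w /=; rewrite in_itv/= andbT.
  rewrite -[X in measurable X]setTI.
  have mf : measurable_fun setT (fun w => (Zs theta w + Ws theta w / 2)%R).
    by apply: measurable_funD => //; exact: measurable_funM.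
  exact: mf.
apply: (@le_trans _ _ (P (sample X eps theta @^-1` A1 `|`
    [set w | (u <= Zs theta w + Ws theta w / 2)%R]))).
  apply: le_measure; rewrite ?inE//; [exact: mpre|by apply: measurableU => //; exact: mpre|].
  move=> w /= Aw.
  have [|ltu] := leP u%R (Zs theta w + Ws theta w / 2)%R; first by right.
  left; split => //=; rewrite ll_sample.
  rewrite (_ : (\sum_a _)%R = Ws theta w); first lra.
  by apply: eq_bigr => a _; field.
apply: (le_trans (measureU2 _ _ _)) => //; first exact: mpre.
apply: leeD; last exact: log_likelihood_tail.
rewrite [leLHS](sample_shift s0 neps indXe indobs theta mA1).
apply: (@le_trans _ _ (\int[P]_(w in sample X eps 0 @^-1` A1) (cst (expR u)%:E w))).
  apply: ge0_le_integral => //.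
  - exact: mpre.
  - by move=> w _; rewrite lee_fin likelihoodE expR_ge0.
  - apply: measurable_funTS; apply/measurable_EFinP.
    exact: measurable_sample_likelihood.
  - move=> w [_ /=]; rewrite ll_sample big1 ?add0r => [llu|a _]; last first.
      by rewrite /dotr mulmx0 mxE !mul0r.
    by rewrite lee_fin likelihoodE ler_expR ltW.
rewrite integral_cst//; last exact: mpre.
apply: lee_wpmul2l; first by rewrite lee_fin expR_ge0.
apply: le_measure; rewrite ?inE; [exact: mpre|exact: mpre|].
by move=> w [].
Qed.

End likelihood_test.

(** * The loss and the reduction to a packing *)

Section quadratic_form.
Context {R : realType} {p : nat}.
Implicit Types (S : 'M[R]_p) (u v : 'cV[R]_p).

Definition quad S u : R := (u^T *m S *m u) 0 0.

Lemma quadE S u : quad S u = \sum_i \sum_j u i 0 * u j 0 * S i j.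
Proof.
rewrite /quad !mxE exchange_big /=; apply: eq_bigr => j _.
rewrite mxE mulr_suml; apply: eq_bigr => i _.
by rewrite mxE mulrAC.
Qed.

Lemma quad_parallelogram S u v :
  quad S (u + v) + quad S (u - v) = 2 * quad S u + 2 * quad S v.
Proof.
rewrite !quadE !mulr_sumr -!big_split/=; apply: eq_bigr => i _.
rewrite !mulr_sumr -!big_split/=; apply: eq_bigr => j _.
by rewrite !mxE; ring.
Qed.

End quadratic_form.

Section design.
Local Open Scope ereal_scope.
Context {R : realType} {d} {T : measurableType d} (P : probability T R) {p : nat}.
Variables (Sigma : 'M[R]_p) (sigma : R).
Variables (X : {RV P >-> p.-tuple R}) (eps : {RV P >-> R}).
Hypothesis design : gaussian_design Sigma sigma X eps.

Let mX i : measurable_fun setT (fun w => tnth (X w) i).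
Proof. exact: (measurableT_comp (measurable_tnth i)). Qed.

Let integral_coordinates i j :
  \int[P]_w (tnth (X w) i * tnth (X w) j)%R%:E = (Sigma i j)%:E.
Proof.
rewrite -(design_cov design) covariance.unlock !(design_mean design) unlock.
apply: eq_integral => w _; congr EFin.
by rewrite -[RHS]/((tnth (X w) i - 0) * (tnth (X w) j - 0))%R !subr0.
Qed.

(** Finite second moments suffice, since [|a b| <= a^2 + b^2]. *)
Let integrable_coordinates i j :
  P.-integrable setT (fun w => (tnth (X w) i * tnth (X w) j)%R%:E).
Proof.
have sq k : P.-integrable setT (fun w => (tnth (X w) k ^+ 2)%R%:E).
  apply/integrableP; split.
    by apply/measurable_EFinP; exact: measurable_funX.
  under eq_integral do rewrite gee0_abs ?lee_fin ?sqr_ge0// expr2.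
  by rewrite integral_coordinates ltry.
apply: (le_integrable measurableT _ _ (integrableD measurableT (sq i) (sq j))).
  by apply/measurable_EFinP; apply: measurable_funM.
move=> w _; rewrite -EFinD !abse_EFin lee_fin [leRHS]ger0_norm ?addr_ge0 ?sqr_ge0//.
rewrite normrM -(real_normK (num_real (tnth (X w) i))).
rewrite -(real_normK (num_real (tnth (X w) j))).
have key (a b : R) : (0 <= a -> 0 <= b -> a * b <= a ^+ 2 + b ^+ 2)%R.
  by move=> a0 b0; have := sqr_ge0 (a - b); have := mulr_ge0 a0 b0; nra.
exact: key.
Qed.

Lemma integral_sqr_dotr (u : 'cV[R]_p) :
  \int[P]_w (dotr (X w) u ^+ 2)%R%:E = (quad Sigma u)%:E.
Proof.
transitivity (\int[P]_w (\sum_i \sum_j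
    (u i 0 * u j 0)%:E * (tnth (X w) i * tnth (X w) j)%R%:E)).
  apply: eq_integral => w _; rewrite dotrE expr2 mulr_suml -sumEFin.
  apply: eq_bigr => i _; rewrite mulr_sumr -sumEFin; apply: eq_bigr => j _.
  by rewrite -EFinM; congr EFin; ring.
have int i j : P.-integrable setT
    (fun w => (u i 0 * u j 0)%:E * (tnth (X w) i * tnth (X w) j)%R%:E).
  exact: integrableZl.
rewrite integral_sum//; last by move=> i; exact: integrable_sum.
rewrite quadE -sumEFin; apply: eq_bigr => i _.
rewrite integral_sum// -sumEFin; apply: eq_bigr => j _.
by rewrite integralZl// integral_coordinates.
Qed.

Lemma quad_ge0 (u : 'cV[R]_p) : (0 <= quad Sigma u)%R.
Proof.
by rewrite -lee_fin -integral_sqr_dotr integral_ge0// => w _; rewrite lee_fin sqr_ge0.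
Qed.

Lemma quadD_le (u v : 'cV[R]_p) :
  (quad Sigma (u + v) <= 2 * quad Sigma u + 2 * quad Sigma v)%R.
Proof. by rewrite -quad_parallelogram lerDl quad_ge0. Qed.

Lemma lossE (theta1 theta2 : 'cV[R]_p) :
  loss X theta1 theta2 = (quad Sigma (theta1 - theta2))%:E.
Proof.
rewrite /loss unlock -integral_sqr_dotr; apply: eq_integral => w _.
by congr (_ ^+ 2)%R%:E; rewrite /dotr mulmxBr !mxE.
Qed.

End design.

Lemma measurable_quad (R : realType) p (S : 'M[R]_p) d' (U : measurableType d')
    (f : U -> 'cV[R]_p) :
  (forall i, measurable_fun setT (fun z => f z i 0)) ->
  measurable_fun setT (fun z => quad S (f z)).
Proof.
move=> mf; under eq_fun do rewrite quadE.
apply: measurable_sum => i; apply: measurable_sum => j.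
by apply: measurable_funM => //; exact: measurable_funM.
Qed.

Section minimax.
Local Open Scope ereal_scope.
Context {R : realType} {p n : nat}.
Context {d0} {T0 : measurableType d0} (P0 : probability T0 R).
Context {d} {T : measurableType d} (P : probability T R).
Variables (Sigma : 'M[R]_p) (sigma : R).
Variables (X0 : {RV P0 >-> p.-tuple R}) (eps0 : {RV P0 >-> R}).
Variables (X : 'I_n -> {RV P >-> p.-tuple R}) (eps : 'I_n -> {RV P >-> R}).
Hypothesis design : gaussian_design Sigma sigma X0 eps0.
Hypothesis iid :
  iid_copies P0 P (fun w => (X0 w, eps0 w)) (fun a w => (X a w, eps a w)).

Let same_law a A B : measurable A -> measurable B ->
  P (X a @^-1` A `&` eps a @^-1` B) = P0 (X0 @^-1` A `&` eps0 @^-1` B).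
Proof. by move=> mA mB; exact: (iid.1 a (A `*` B) (measurableX mA mB)). Qed.

Let same_lawX a A : measurable A -> P (X a @^-1` A) = P0 (X0 @^-1` A).
Proof.
by move=> mA; have := same_law a mA measurableT; rewrite !preimage_setT !setIT.
Qed.

Let same_law_eps a B : measurable B -> P (eps a @^-1` B) = P0 (eps0 @^-1` B).
Proof.
by move=> mB; have := same_law a measurableT mB; rewrite !preimage_setT !setTI.
Qed.

Let normal_eps a : normal_law P (eps a) 0 sigma.
Proof. by move=> B mB; rewrite same_law_eps//; exact: (noise_normal design). Qed.

Let independent_noise a : independent2 P (X a) (eps a).
Proof.
move=> A B mA mB; rewrite same_law// same_lawX// same_law_eps//.
exact: (noise_independent design).
Qed.

Lemma integral_sqr_dotr_copy a (u : 'cV[R]_p) :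
  \int[P]_w (dotr (X a w) u ^+ 2)%R%:E = (quad Sigma u)%:E.
Proof.
rewrite -(integral_sqr_dotr design).
pose g (x : p.-tuple R) := (dotr x u ^+ 2)%R%:E.
transitivity (\int[P]_w (g (X a w) * (cst 1%R w)%:E)).
  by apply: eq_integral => w _; rewrite mule1.
transitivity (\int[P0]_w (g (X0 w) * (cst 1%R w)%:E)); last first.
  by apply: eq_integral => w _; rewrite mule1.
apply: ge0_integral_comp_weight_eq => //.
- move=> B mB.
  have mXB : measurable (X a @^-1` B) by exact: measurable_funPTI.
  have mX0B : measurable (X0 @^-1` B) by exact: measurable_funPTI.
  rewrite (integral_cst P mXB 1) (integral_cst P0 mX0B 1).
  by congr (_ * _); exact: same_lawX.
- apply/measurable_EFinP; apply: measurable_funX.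
  exact: (measurable_dotr u (X := id)).
- by move=> x; rewrite lee_fin sqr_ge0.
Qed.

(** Reduction of estimation to testing among [M] parameters, all compared with the law under 0. The
    factor [40 = 4 * 10] combines a loss of at least [Delta / 4] with an error probability of at
    least 1/10. *)
Lemma packing_minimax_bound (M : nat) (theta : 'I_M -> 'cV[R]_p)
    (Theta : set 'cV[R]_p) (Delta : R) :
  sigma != 0%R -> (1 < M)%N -> (0 <= Delta)%R ->
  (forall j, Theta (theta j)) ->
  (forall i j, i != j -> (Delta <= quad Sigma (theta i - theta j))%R) ->
  (forall j, (n%:R * quad Sigma (theta j) / sigma ^+ 2 <= ln M%:R / 340)%R) ->
  (Delta / 40)%:E <= minimax_risk P X0 X eps Theta.
Proof.
move=> s0 M1 D0 ThetaP sep near0.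
have M0 : (0 < M%:R :> R)%R by rewrite ltr0n (ltn_trans _ M1).
have lnM0 : (0 < ln M%:R :> R)%R by rewrite ln_gt0// ltr1n.
apply: le_ereal_inf_tmp => _ [thetahat mth <-].
(* Radius [Delta / 4], because [quadD_le] loses a factor 2: two estimates of loss below [Delta / 4]
   would put their targets at distance below [Delta]. This makes the sets disjoint. *)
pose A j := [set z | (quad Sigma (thetahat z - theta j) < Delta / 4)%R].
have mq j : measurable_fun setT (fun z => quad Sigma (thetahat z - theta j)).
  apply: measurable_quad => i.
  rewrite [X in measurable_fun _ X](_ : _ =
    fun z => (thetahat z i 0 - theta j i 0)%R); last first.
    by apply/funext => z; rewrite !mxE.
  by apply: measurable_funB => //; exact: mth.
have mA j : measurable (A j).
  rewrite (_ : A j =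
    (fun z => quad Sigma (thetahat z - theta j)) @^-1` `]-oo, (Delta / 4)%R[).
    by rewrite -[X in measurable X]setTI; exact: mq.
  by apply/seteqP; split => z; rewrite /A /= in_itv.
have tA : trivIset setT A.
  apply/trivIsetP => i j _ _ ij; apply/seteqP; split => // z [Ai Aj].
  have := sep _ _ ij.
  rewrite (_ : theta i - theta j = (thetahat z - theta j) + - (thetahat z - theta i))%R;
    last by rewrite opprB [RHS]addrC addrA subrK.
  have := quadD_le design (thetahat z - theta j) (- (thetahat z - theta i)).
  have -> : quad Sigma (- (thetahat z - theta i)) = quad Sigma (thetahat z - theta i).
    rewrite !quadE; apply: eq_bigr => k _; apply: eq_bigr => l _.
    by rewrite !mxE; ring.
  move: Ai Aj; rewrite /A /=; lra.
(* With this threshold [expR u] is the square root of [M]. *)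
pose u : R := (ln M%:R / 2)%R.
have u0 : (0 < u)%R by rewrite divr_gt0.
(* The tail bound with [t = 16] and [nu = ln M / 340]: its first term is [M^(-4) <= 1/16], its
   second is [17 * 2 / 340 = 1/10]. *)
pose b : R := (expR (- (16 * u / 2)) + (16 + 1) * (ln M%:R / 340) / u)%R.
have tb j : P (sample X eps (theta j) @^-1` A j) <=
    (expR u)%:E * P (sample X eps 0 @^-1` A j) + b%:E.
  apply: (likelihood_test_bound s0 normal_eps independent_noise iid.2) => //.
  under eq_integral do rewrite -sumEFin.
  rewrite ge0_integral_sum//; first last.
  - by move=> a w _; rewrite lee_fin sqr_ge0.
  - move=> a; apply/measurable_EFinP; apply: measurable_funX.
    by apply: measurable_funM => //; exact: measurable_dotr.
  rewrite (eq_bigr (fun=> (quad Sigma (theta j) / sigma ^+ 2)%:E)); last first.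
    move=> a _; under eq_integral do rewrite expr_div_n mulrC EFinM.
    rewrite ge0_integralZl_EFin ?invr_ge0 ?sqr_ge0//.
    + by rewrite integral_sqr_dotr_copy -EFinM mulrC.
    + by move=> w _; rewrite lee_fin sqr_ge0.
    + by apply/measurable_EFinP; apply: measurable_funX; exact: measurable_dotr.
  rewrite sumEFin lee_fin sumr_const card_ord -[leLHS]mulr_natl mulrA.
  exact: near0.
have mpre t B : measurable B -> measurable (sample X eps t @^-1` B).
  by move=> mB; exact: measurable_sample_preimage.
pose x j := fine (P (sample X eps (theta j) @^-1` A j)).
pose y j := fine (P (sample X eps 0 @^-1` A j)).
have xE j : (x j)%:E = P (sample X eps (theta j) @^-1` A j).
  by rewrite fineK// fin_num_measure//; exact: mpre.
have yE j : (y j)%:E = P (sample X eps 0 @^-1` A j).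
  by rewrite fineK// fin_num_measure//; exact: mpre.
have sumy : (\sum_j y j <= 1)%R.
  rewrite -lee_fin -sumEFin; under eq_bigr do rewrite yE.
  rewrite -(measure_bigsetU_ord P xpredT).
  - apply: probability_le1; apply: bigsetU_measurable => j _; exact: mpre.
  - by move=> j; exact: mpre.
  - apply/trivIsetP => i j _ _ ij; rewrite -preimage_setI.
    by move/trivIsetP: tA => /(_ i j I I ij) ->; rewrite preimage_set0.
have xy j : (x j <= expR u * y j + b)%R.
  by rewrite -lee_fin EFinD EFinM xE yE; exact: tb.
have M2 : (2 <= M%:R :> R)%R by rewrite (ler_nat R 2).
have b_le : (b <= 1/16 + 1/10)%R.
  rewrite /b; apply: lerD.
    rewrite (_ : - (16 * u / 2) = - (4%:R * ln M%:R))%R; last by rewrite /u; field.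
    rewrite expRN expRM_natl lnK ?posrE// div1r lef_pV2 ?posrE ?exprn_gt0//.
    by rewrite (_ : 16 = 2 ^+ 4)%R; [apply: lerXn2r => //; rewrite nnegrE|ring].
  by rewrite (_ : (_ / u = 1 / 10)%R)//; rewrite /u; field; rewrite gt_eqF.
have Eu2 : (expR u ^+ 2 = M%:R)%R.
  by rewrite -expRM_natl /u mulrC divfK// lnK// posrE.
(* Otherwise summing over [j], with the null probabilities adding up to at most 1, gives
   [9/10 M <= sqrt M + (1/16 + 1/10) M], that is [59/80 M <= sqrt M], which fails for [M >= 2]. *)
have [j xj] : exists j, (x j <= 9/10)%R.
  apply/not_existsP => H.
  have lt_x : (9/10 * M%:R <= \sum_j x j)%R.
    rewrite (_ : _ * _ = \sum_(j < M) (9/10 : R))%R; last first.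
      by rewrite sumr_const card_ord mulr_natr.
    apply: ler_sum => j _.
    by have /negP := H j; rewrite -ltNge => /ltW.
  have : (\sum_j x j <= expR u * \sum_j y j + b * M%:R)%R.
    rewrite (_ : b * _ = \sum_(j < M) b)%R; last first.
      by rewrite sumr_const card_ord mulr_natr.
    rewrite mulr_sumr -big_split/=.
    by apply: ler_sum => j _; exact: xy.
  have := ler_wpM2l (expR_ge0 u) sumy; have := expR_gt0 u.
  move: b_le lt_x Eu2 M2; set E := expR u; set N := M%:R%R.
  set sx := (\sum_j x j)%R; set sy := (\sum_j y j)%R => b_le lt_x EN N2 E0 Esy sxy.
  have bN : (b * N <= (1/16 + 1/10) * N)%R by apply: ler_wpM2r => //; exact: ltW.
  have : (59/80 * N <= E)%R by lra.
  rewrite -EN in N2 *; nra.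
apply: (@le_trans _ _ (risk P X0 X eps thetahat (theta j))); last first.
  by apply: ereal_sup_ubound; exists (theta j).
rewrite /risk; under eq_integral do rewrite (lossE design).
have mB : measurable (sample X eps (theta j) @^-1` ~` A j).
  by apply: mpre; exact: measurableC.
(* Outside [A j] the loss is at least [Delta / 4], and this has probability [1 - x j >= 1/10]. *)
apply: (@le_trans _ _ (\int[P]_w
    ((Delta / 4)%:E * (\1_(sample X eps (theta j) @^-1` ~` A j) w)%:E))).
  rewrite ge0_integralZl_EFin//; first last.
  - by rewrite divr_ge0.
  - by apply/measurable_EFinP; exact: measurable_indic.
  rewrite integral_indic// setIT preimage_setC [X in _ * X](_ : _ = (1 - x j)%:E).
    by rewrite -EFinM lee_fin; nra.
  by rewrite EFinB xE; exact: (probability_setC P (mpre _ _ (mA j))).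
apply: ge0_le_integral => //.
- by move=> w _; rewrite mule_ge0 ?lee_fin ?divr_ge0.
- apply/measurable_EFinP; apply: measurable_funM => //; exact: measurable_indic.
- apply/measurable_EFinP.
  exact: (measurableT_comp (mq j) (measurable_sample X eps (theta j))).
- move=> w _; rewrite indicE; have [wA|wA] := boolP (w \in _); last first.
    by rewrite mule0 lee_fin (quad_ge0 design).
  by rewrite mule1 lee_fin leNgt; move: wA; rewrite inE => /negP.
Qed.

End minimax.

(** * Sparse packings *)

Section codes.
Local Open Scope nat_scope.

(** Take a separated set that is maximal for inclusion: a point close to none of its elements could
    be added to it. Reflexivity covers the points of the set itself. *)
Lemma maximal_packing (T : finType) (close : rel T) :
  reflexive close -> symmetric close ->
  exists C : {set T}, (forall x y, x \in C -> y \in C -> x != y -> ~~ close x y) /\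
    forall x, exists2 y, y \in C & close x y.
Proof.
move=> cxx csym.
pose separated (C : {set T}) :=
  [forall x in C, forall y in C, (x != y) ==> ~~ close x y].
have sep0 : separated finset.set0 by apply/forall_inP => x; rewrite inE.
have [C /maxsetP[sepC maxC] _] := maxset_exists sep0.
have {}sepC x y : x \in C -> y \in C -> x != y -> ~~ close x y.
  by move=> xC yC; move/forall_inP: sepC => /(_ x xC)/forall_inP/(_ y yC)/implyP.
exists C; split => // x; have [/exists_inP//|/exists_inPn nC] :=
  boolP [exists y in C, close x y].
suff /maxC/(_ (finset.subsetUr _ _)) xC : separated (x |: C).
  by exists x => //; rewrite -xC finset.setU11.
apply/forall_inP => y /finset.setU1P[->|yC]; apply/forall_inP => z /finset.setU1P[->|zC];
  apply/implyP => yz.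
- by rewrite eqxx in yz.
- exact: nC.
- by rewrite csym; exact: nC.
- exact: sepC.
Qed.

Definition hdist k q (v w : {ffun 'I_k -> 'I_q}) := #|[pred i | v i != w i]|.

(* Weigh a word by [2q] per letter shared with the centre [w]: the words of a
   given ball have a large weight, but all weights add up to at most [(3q)^k]. *)
Lemma hamming_ball_card k q d (w : {ffun 'I_k -> 'I_q}) : 0 < q ->
  #|[set v | hdist v w <= d]%SET| * (2 * q) ^ (k - d) <= (3 * q) ^ k.
Proof.
move=> q0.
pose weight i (x : 'I_q) := if x == w i then 2 * q else 1.
have sum_weight i : \sum_x weight i x <= 3 * q.
  rewrite (bigD1 (w i))//= /weight eqxx mulSn addnC leq_add//.
  rewrite (eq_bigr (fun=> 1)); last by move=> x /negbTE ->.
  by rewrite sum1_card (leq_trans (max_card _))// card_ord.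
apply: (@leq_trans (\sum_(v : {ffun 'I_k -> 'I_q}) \prod_i weight i (v i)));
  last first.
  (* The sum over words of a product over letters is the product of the sums over letters, each at
     most [3 * q]. *)
  rewrite -bigA_distr_bigA -[in leqRHS](card_ord k) -prod_nat_const.
  by apply: leq_prod => i _.
rewrite -sum_nat_const big_mkcond; apply: leq_sum => v _; rewrite inE.
case: ifP => // vw.
rewrite (bigID (fun i => v i == w i))/= [leqRHS]mulnC big1 ?mul1n; last first.
  by move=> i /negbTE viw; rewrite /weight viw.
rewrite (eq_bigr (fun=> 2 * q)); last by move=> i viw; rewrite /weight viw.
rewrite prod_nat_const leq_pexp2l ?muln_gt0// leq_subLR.
(* A word of the ball agrees with the centre in at least [k - d] letters. *)
apply: (@leq_trans (hdist v w + #|[pred i | v i == w i]|)); last by rewrite leq_add2r.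
by rewrite -{1}(card_ord k) -(cardC [pred i | v i == w i]) addnC leq_add2r.
Qed.

(** The Gilbert argument: balls of radius [k %/ 8] around a maximal packing cover all [q ^ k] words,
    so the bound on the size of a ball bounds the number of centres from below. Eighth powers keep
    everything in natural numbers. *)
Lemma good_code k q : 1 < q -> exists C : {set {ffun 'I_k -> 'I_q}},
  (forall v w, v \in C -> w \in C -> v != w -> k < 8 * hdist v w) /\
  q ^ k <= #|C| ^ 8.
Proof.
move=> q1; have q0 : 0 < q by exact: ltnW.
pose d := k %/ 8.
have dk : 8 * d <= k by rewrite mulnC leq_trunc_div.
have [|v w|C [sepC covC]] := @maximal_packing _ (fun v w => @hdist k q v w <= d).
- move=> v; rewrite /hdist (_ : #|_| = 0)//.
  by apply: eq_card0 => i; rewrite inE eqxx.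
- by congr (_ <= _); apply: eq_card => i; rewrite !inE eq_sym.
exists C; split=> [v w vC wC vw|].
  have := sepC v w vC wC vw; rewrite -ltnNge /d ltn_divLR// mulnC//.
have H : (2 * q) ^ (k - d) <= #|C| * 3 ^ k.
  rewrite -(leq_pmul2l (m := q ^ k)) ?expn_gt0 ?q0//.
  rewrite mulnCA -expnMn [q * 3]mulnC.
  have -> : q ^ k = #|{ffun 'I_k -> 'I_q}| by rewrite card_ffun !card_ord.
  have /subset_leq_card/leq_trans le : [set: {ffun 'I_k -> 'I_q}]%SET \subset
      (\bigcup_(c in C) [set v | hdist v c <= d])%SET.
    apply/fintype.subsetP => v _; have [c cC vc] := covC v.
    by apply/finset.bigcupP; exists c => //; rewrite inE.
  rewrite -cardsT -[leqRHS]sum_nat_const.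
  apply: (@leq_trans (\sum_(c in C) #|[set v | hdist v c <= d]%SET| * (2 * q) ^ (k - d))).
    rewrite -big_distrl /= leq_mul2r; apply/orP; right; apply: le.
    elim/big_ind2: _ => [|m A m' B Am Bm'|//]; first by rewrite cards0.
    by apply: leq_trans (leq_add Am Bm'); rewrite leq_card_setU.
  by apply: leq_sum => c _; exact: hamming_ball_card.
(* Since [8 * d <= k], the exponent [8 * (k - d)] is at least [7 * k]. *)
have H8 : (2 * q) ^ (7 * k) <= #|C| ^ 8 * (3 ^ 8) ^ k.
  have -> : (3 ^ 8) ^ k = (3 ^ k) ^ 8 by rewrite -!expnM mulnC.
  rewrite -expnMn.
  apply: (@leq_trans (((2 * q) ^ (k - d)) ^ 8)); last by rewrite leq_exp2r.
  by rewrite -expnM leq_pexp2l ?muln_gt0//; lia.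
(* After division by [q] this is [3 ^ 8 <= 2 ^ 7 * q ^ 6]; for [q >= 2] the right side is at least
   [2 ^ 13 = 8192], and [3 ^ 8 = 6561]. *)
have q7 : 3 ^ 8 * q <= (2 * q) ^ 7.
  rewrite expnMn (expnS q 6) mulnCA mulnC leq_pmul2l//.
  by apply: (@leq_trans (2 ^ 7 * 2 ^ 6)) => //; rewrite leq_pmul2l// leq_exp2r.
rewrite -(leq_pmul2r (m := (3 ^ 8) ^ k)) ?expn_gt0//.
apply: leq_trans H8; rewrite expnM -expnMn.
case: k {H C sepC covC d dk} => // k; rewrite leq_exp2r//.
by rewrite mulnC.
Qed.

End codes.

Section sparse_packing.
Context {R : realType} {p k q : nat}.
Hypothesis kq_le_p : (k * q <= p)%N.
Implicit Types (v w : {ffun 'I_k -> 'I_q}) (rho : R).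

Lemma block_index_subproof (i : 'I_k) (x : 'I_q) : (i * q + x < p)%N.
Proof.
apply: leq_trans kq_le_p; rewrite (@leq_trans (i.+1 * q))//.
  by rewrite mulSn addnC ltn_add2r.
by rewrite leq_mul2r ltn_ord orbT.
Qed.

Definition block_index i x : 'I_p := Ordinal (block_index_subproof i x).

Lemma block_index_inj i j x y :
  block_index i x = block_index j y -> i = j /\ x = y.
Proof.
move=> /(congr1 val)/= E.
have q0 : (0 < q)%N by apply: leq_ltn_trans (ltn_ord x).
split; apply: val_inj => /=.
- have := congr1 (fun m => m %/ q)%N E.
  by rewrite !divnMDl// !divn_small ?ltn_ord// !addn0.
- have := congr1 (fun m => m %% q)%N E.
  by rewrite !modnMDl !modn_small ?ltn_ord.
Qed.

Definition word_support w : {set 'I_p} := [set block_index i (w i) | i : 'I_k]%SET.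

Lemma mem_word_support w i x : (block_index i x \in word_support w) = (w i == x).
Proof.
apply/imsetP/eqP => [[j _ /block_index_inj[-> ->]]//|<-].
by exists i.
Qed.

Lemma card_word_support w : (#|word_support w| <= k)%N.
Proof. by rewrite (leq_trans (leq_imset_card _ _))// card_ord. Qed.

Definition word_vector rho w : 'cV[R]_p := \col_j (rho * (j \in word_support w)%:R).

Lemma enorm_sqr (u : 'cV[R]_p) : enorm u ^+ 2 = \sum_i u i 0 ^+ 2.
Proof. by rewrite sqr_sqrtr// sumr_ge0// => i _; rewrite sqr_ge0. Qed.

Lemma sparse_word_vector rho w : sparse k (word_vector rho w).
Proof.
apply: leq_trans (card_word_support w); apply: subset_leq_card.
apply/fintype.subsetP => j; rewrite !inE mxE.
by case: (j \in _) => //; rewrite mulr0 eqxx.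
Qed.

Lemma sparse_word_vectorB rho v w :
  sparse (2 * k) (word_vector rho v - word_vector rho w).
Proof.
rewrite /sparse /= mul2n -addnn.
apply: leq_trans (leq_add (card_word_support v) (card_word_support w)).
apply: (@leq_trans #|word_support v :|: word_support w|); last first.
  by rewrite leq_card_setU.
apply: subset_leq_card; apply/fintype.subsetP => j; rewrite !inE !mxE.
case: (j \in word_support v) => //=; case: (j \in word_support w) => //=.
by rewrite mulr0 subr0 eqxx.
Qed.

Lemma enorm_word_vector rho w : enorm (word_vector rho w) ^+ 2 <= rho ^+ 2 * k%:R.
Proof.
rewrite enorm_sqr (eq_bigr (fun j => rho ^+ 2 * (j \in word_support w)%:R)).
  rewrite -mulr_sumr ler_wpM2l ?sqr_ge0// -natr_sum ler_nat.
  apply: leq_trans (card_word_support w); rewrite -sum1_card [leqRHS]big_mkcond.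
  by apply: leq_sum => j _; case: (j \in _).
by move=> j _; rewrite mxE exprMn; case: (j \in _); rewrite ?expr1n ?expr0n.
Qed.

(** Only the coordinates selected by [v] in the blocks where the two words differ are kept; there
    the second vector vanishes, and each contributes [rho ^+ 2]. *)
Lemma enorm_word_vectorB rho v w :
  rho ^+ 2 * (hdist v w)%:R <=
  enorm (word_vector rho v - word_vector rho w) ^+ 2.
Proof.
rewrite enorm_sqr.
have inj : {in [pred i | v i != w i] &, injective (fun i => block_index i (v i))}.
  by move=> i j _ _ /block_index_inj[].
pose D := [set block_index i (v i) | i in [pred i | v i != w i]]%SET.
rewrite (bigID (mem D))/= -[leLHS]addr0 lerD//; last first.
  by rewrite sumr_ge0// => j _; rewrite sqr_ge0.
rewrite big_imset//= (eq_bigr (fun=> rho ^+ 2)); last first.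
  move=> i vw; rewrite !mxE !mem_word_support eqxx eq_sym (negbTE vw).
  by rewrite mulr1 mulr0 subr0.
by rewrite sumr_const mulr_natr.
Qed.

End sparse_packing.

(** * Rescaling to the correlation matrix and choice of the constants *)

Section rescaling.
Context {R : realType} {p : nat} (Sigma : 'M[R]_p).
Hypothesis Sigma_ge1 : forall i, 1 <= Sigma i i.

Definition rescale (b : 'cV[R]_p) : 'cV[R]_p :=
  \col_i (b i 0 / Num.sqrt (Sigma i i)).

Lemma rescaleB (b c : 'cV[R]_p) : rescale b - rescale c = rescale (b - c).
Proof. by apply/matrixP => i j; rewrite !mxE mulrBl. Qed.

Lemma quad_rescale (b : 'cV[R]_p) :
  quad Sigma (rescale b) = quad (correlation_mx Sigma) b.
Proof.
have S0 i : 0 <= Sigma i i by rewrite (le_trans _ (Sigma_ge1 i)).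
rewrite !quadE; apply: eq_bigr => i _; apply: eq_bigr => j _.
by rewrite !mxE sqrtrM// invfM; ring.
Qed.

Lemma sparse_box_rescale k (r : R) (b : 'cV[R]_p) :
  sparse_box k r b -> sparse_box k r (rescale b).
Proof.
move=> [sb br]; split.
  apply: leq_trans sb; apply: subset_leq_card; apply/fintype.subsetP => i.
  by rewrite !inE mxE; apply: contraNN => /eqP ->; rewrite mul0r.
move=> i; apply: le_trans (br i); rewrite mxE normrM ler_piMr//.
rewrite normfV ger0_norm ?sqrtr_ge0// invf_le1 ?sqrtr_gt0.
  by rewrite -[leLHS]sqrtr1 ler_wsqrtr.
by rewrite (lt_le_trans _ (Sigma_ge1 i)).
Qed.

End rescaling.

Lemma ln2_ge_half (R : realType) : 1 / 2 <= ln 2 :> R.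
Proof.
(* The inequality [ln (1 + x) <= x] at [x = -1/2] reads [- ln 2 <= - 1/2]. *)
have := @le_ln1Dx R (- (1 / 2)).
rewrite (_ : 1 + - (1/2) = 2^-1); last by field.
by rewrite lnV ?posrE// lerN2; apply; lra.
Qed.

Lemma minimax_risk_ge0 (R : realType) n p d0 (T0 : measurableType d0)
    (P0 : probability T0 R) (X0 : {RV P0 >-> p.-tuple R}) d (T : measurableType d)
    (P : probability T R) (X : 'I_n -> T -> p.-tuple R) (eps : 'I_n -> T -> R)
    (Theta : set 'cV[R]_p) :
  Theta !=set0 -> (0 <= minimax_risk P X0 X eps Theta)%E.
Proof.
move=> [theta Ttheta]; apply: le_ereal_inf_tmp => _ [thetahat _ <-].
apply: (@le_trans _ _ (risk P X0 X eps thetahat theta)); last first.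
  by apply: ereal_sup_ubound; exists theta.
apply: integral_ge0 => w _; rewrite /loss unlock.
by apply: integral_ge0 => w' _; rewrite lee_fin sqr_ge0.
Qed.

(** Passing from [p / k] to its integer part [q >= 2] costs only a constant:
    [p / k < q + 1 <= q ^ 2] gives [2 * ln q], and [1 <= 2 * ln 2 <= 2 * ln q] absorbs the summand
    1. *)
Lemma log_ratio_le (R : realType) (p k : nat) : (0 < k)%N -> (2 * k < p)%N ->
  1 + ln (p%:R / k%:R) <= 4 * ln (p %/ k)%:R :> R.
Proof.
move=> k0 kp; set q := (p %/ k)%N.
have q2 : (2 <= q)%N by rewrite leq_divRL// ltnW.
have kR0 : 0 < k%:R :> R by rewrite ltr0n.
have qR0 : 0 < q%:R :> R by rewrite ltr0n (ltn_trans _ q2).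
have pR0 : 0 < p%:R :> R by rewrite ltr0n (leq_ltn_trans _ kp).
have lnq : 1 / 2 <= ln q%:R :> R.
  by apply: le_trans (ln2_ge_half R) _; rewrite ler_ln ?posrE// ler_nat.
have : ln (p%:R / k%:R) <= ln (q%:R ^+ 2) :> R.
  rewrite ler_ln ?posrE ?divr_gt0 ?exprn_gt0// ler_pdivrMr//.
  rewrite -natrX -natrM ler_nat.
  have := ltn_ceil p k0; rewrite -/q => pq.
  apply: leq_trans (ltnW pq) _; rewrite leq_mul2r; apply/orP; right.
  by nia.
rewrite lnXn// mulr2n; lra.
Qed.

(* The hypothesis [1 <= Sigma i i] fixes the scale of the covariates (it holds
   for standardized ones). The radius r is expressed in the units of theta
   whereas the loss scales with Sigma, so without it the bound is false. *)
Theorem proposition4p5 (R : realType) :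
  exists L : R, 0 < L /\
  forall (p k n : nat) (Sigma : 'M[R]_p) (sigma delta : R)
    (d0 : measure_display) (T0 : measurableType d0) (P0 : probability T0 R)
    (X0 : {RV P0 >-> p.-tuple R}) (eps0 : {RV P0 >-> R})
    (d : measure_display) (T : measurableType d) (P : probability T R)
    (X : 'I_n -> {RV P >-> p.-tuple R}) (eps : 'I_n -> {RV P >-> R}),
  0 <= sigma ->
  gaussian_design Sigma sigma X0 eps0 ->
  iid_copies P0 P (fun w => (X0 w, eps0 w)) (fun a w => (X a w, eps a w)) ->
  (forall i, 1 <= Sigma i i) ->
  (0 < n)%N -> (0 < k)%N -> k%:R < p%:R / 2 :> R -> 0 < delta ->
  (forall theta : 'cV[R]_p, sparse (2 * k) theta ->
     (1 - delta) ^+ 2 * enorm theta ^+ 2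
       <= (theta^T *m correlation_mx Sigma *m theta) 0 0
       <= (1 + delta) ^+ 2 * enorm theta ^+ 2) ->
  forall r : R, 0 < r ->
  ((L * (1 - delta) ^+ 2 * k%:R *
    Num.min (r ^+ 2)
      (sigma ^+ 2 * ((1 + ln (p%:R / k%:R)) / ((1 + delta) ^+ 2 * n%:R))))%:E
   <= minimax_risk P X0 X eps (sparse_box k r))%E.
Proof.
(* [c] will be the ratio of [rho ^+ 2] to the minimum in the statement. The value [c * 32 = 1 / 340]
   fits the factor 32 of [lnC] into the information allowed by [packing_minimax_bound]. *)
have [c [c0 c1 cE]] : exists c : R, [/\ 0 < c, c <= 1 & c * 32 = 1 / 340].
  by exists (1 / 340 / 32); split; [lra|lra|field].
(* Here [320 = 8 * 40]: 8 comes from the minimum distance [k / 8] of the code, 40 from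
   [packing_minimax_bound]. *)
exists (c / 320); split; first by lra.
move=> p k n Sigma sigma delta d0 T0 P0 X0 eps0 d T P X eps _ design iid Sigma1.
move=> n0 k0 kp2 delta0 RIP r r0.
have kp : (2 * k < p)%N.
  by rewrite -(ltr_nat R) natrM; move: kp2; rewrite ltr_pdivlMr// mulrC.
(* Without noise there is no likelihood ratio, but the minimum is then 0 and nonnegativity of the
   risk is enough. *)
have [sigma0|sigma0] := eqVneq sigma 0.
  rewrite sigma0 expr0n/= mul0r min_r ?sqr_ge0// mulr0.
  apply: minimax_risk_ge0; exists 0; split=> [|i]; last by rewrite mxE normr0 ltW.
  by rewrite /sparse /= (eq_card0 (A := _)) // => i; rewrite !inE mxE eqxx.
set q := (p %/ k)%N.
have q2 : (1 < q)%N by rewrite leq_divRL// ltnW.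
have kq_le_p : (k * q <= p)%N by rewrite mulnC leq_trunc_div.
have [C [sepC cardC]] := good_code k q2.
have kR0 : 0 < k%:R :> R by rewrite ltr0n.
have nR0 : 0 < n%:R :> R by rewrite ltr0n.
have pk0 : 0 < ln (p%:R / k%:R) :> R.
  by rewrite ln_gt0// ltr_pdivlMr// mul1r ltr_nat (leq_ltn_trans _ kp)// leq_pmull.
have C1 : (1 < #|C|)%N.
  rewrite ltnNge; apply/negP => C1.
  have : (#|C| ^ 8 <= 1 ^ 8)%N by rewrite leq_exp2r.
  rewrite exp1n leqNgt => /negP; apply; apply: leq_trans cardC.
  by rewrite -(exp1n k) ltn_exp2r.
(* The factor is [32 = 8 * 4], from the eighth power in [good_code] and from [log_ratio_le]. *)
have lnC : k%:R * (1 + ln (p%:R / k%:R)) <= 32 * ln #|C|%:R :> R.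
  have C0 : (0 < #|C|)%N by exact: ltnW.
  have qR0 : 0 < q%:R :> R by rewrite ltr0n ltnW.
  have : k%:R * ln q%:R <= 8 * ln #|C|%:R :> R.
    have : ln (q%:R ^+ k) <= ln (#|C|%:R ^+ 8) :> R.
      rewrite ler_ln ?posrE ?exprn_gt0// ?ltr0n//.
      by rewrite -!natrX ler_nat.
    by rewrite (lnXn _ qR0) (lnXn _ (_ : 0 < #|C|%:R)) ?ltr0n// !mulr_natl.
  have := ler_wpM2l (ltW kR0) (log_ratio_le R k0 kp); rewrite -/q; lra.
set m := Num.min _ _.
have m0 : 0 <= m.
  rewrite le_min sqr_ge0 mulr_ge0 ?sqr_ge0// divr_ge0 ?addr_ge0 ?(ltW pk0)//.
  by rewrite mulr_ge0 ?sqr_ge0.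
(* As [c <= 1], the bound [m <= r ^+ 2] keeps the entries in the box; the other bound on [m] limits
   the information. *)
pose rho := Num.sqrt (c * m).
have rho2 : rho ^+ 2 = c * m by rewrite sqr_sqrtr// mulr_ge0// ltW.
have rho_le : rho <= r.
  rewrite -[leRHS](ger0_norm (ltW r0)) -sqrtr_sqr /rho ler_wsqrtr//.
  have : m <= r ^+ 2 by rewrite ge_min lexx.
  by nra.
pose theta (j : 'I_#|C|) := rescale Sigma (word_vector kq_le_p rho (enum_val j)).
pose Delta := (1 - delta) ^+ 2 * (rho ^+ 2 * (k%:R / 8)).
have -> : c / 320 * (1 - delta) ^+ 2 * k%:R * m = Delta / 40.
  by rewrite /Delta rho2; field.
apply: (packing_minimax_bound design iid (theta := theta)) => //.
- by rewrite mulr_ge0 ?sqr_ge0// mulr_ge0 ?sqr_ge0// divr_ge0// ltW.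
- move=> j; apply: sparse_box_rescale => //; split; first exact: sparse_word_vector.
  move=> i; rewrite mxE; case: (_ \in _).
    by rewrite mulr1 (ger0_norm (sqrtr_ge0 _)).
  by rewrite mulr0 normr0 (ltW r0).
(* Separation: a difference of two word vectors is [2 * k]-sparse, so the lower isometry bound
   applies, and the code supplies more than [k / 8] differing blocks. *)
- move=> i j ij; rewrite rescaleB quad_rescale//.
  have /andP[+ _] := RIP _ (sparse_word_vectorB kq_le_p rho (enum_val i) (enum_val j)).
  apply: le_trans; rewrite ler_wpM2l ?sqr_ge0//.
  apply: le_trans (enorm_word_vectorB kq_le_p rho _ _).
  rewrite ler_wpM2l ?sqr_ge0// ler_pdivrMr// -natrM ler_nat mulnC ltnW//.
  by apply: sepC; rewrite ?enum_valP// (inj_eq enum_val_inj).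
(* Information: the upper isometry factor [(1 + delta) ^+ 2] and [n] cancel the denominator in the
   bound on [m], leaving [c * k * (1 + ln (p / k))], which [lnC] compares with [ln #|C|]. *)
- move=> j; rewrite quad_rescale//.
  have s2 : sparse (2 * k) (word_vector kq_le_p rho (enum_val j)).
    apply: leq_trans (sparse_word_vector kq_le_p rho _) _.
    by rewrite leq_pmull.
  have /andP[_ +] := RIP _ s2.
  rewrite -/(quad _ _) => quad_le.
  have := enorm_word_vector kq_le_p rho (enum_val j); rewrite rho2 => norm_le.
  have m_le : m <= sigma ^+ 2 * ((1 + ln (p%:R / k%:R)) / ((1 + delta) ^+ 2 * n%:R)).
    by rewrite ge_min lexx orbT.
  have sigma2 : 0 < sigma ^+ 2 by rewrite exprn_even_gt0.
  have delta1 : 0 < (1 + delta) ^+ 2 by rewrite exprn_gt0// addr_gt0.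
  rewrite ler_pdivrMr// (@le_trans _ _ (n%:R * ((1 + delta) ^+ 2 * (c * m * k%:R))))//.
    apply: ler_wpM2l; first exact: ltW.
    by apply: (le_trans quad_le); apply: ler_wpM2l => //; exact: ltW.
  have -> : n%:R * ((1 + delta) ^+ 2 * (c * m * k%:R)) =
      (n%:R * (1 + delta) ^+ 2 * c * k%:R) * m by ring.
  apply: (le_trans (ler_wpM2l _ m_le)).
    exact: (mulr_ge0 (mulr_ge0 (mulr_ge0 (ltW nR0) (ltW delta1)) (ltW c0)) (ltW kR0)).
  have -> : n%:R * (1 + delta) ^+ 2 * c * k%:R *
      (sigma ^+ 2 * ((1 + ln (p%:R / k%:R)) / ((1 + delta) ^+ 2 * n%:R))) =
      c * (k%:R * (1 + ln (p%:R / k%:R))) * sigma ^+ 2.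
    by field; rewrite !gt_eqF// addr_gt0.
  apply: ler_wpM2r; first exact: ltW.
  apply: (le_trans (ler_wpM2l (ltW c0) lnC)).
  by rewrite mulrA cE; lra.
Qed.
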